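(* Let $n,m\ge 1$ be integers and let $\mathbf{k}=(k_1,\ldots,k_n)$ be an $n$-tuple of positive real numbers satisfying $\sum_{i=1}^n k_i=1$. Let $\Theta\in\mathrm{Bad}(\mathbf{k},n,m)$ and let $\mathcal{C}\subset\mathbb{R}^n$ be an everywhere non-degenerate $C^{(1)}$ curve. Then the set $\mathrm{Bad}_{\Theta}(\mathbf{k},n,m)\cap\mathcal{C}$ is winning (for Schmidt's game played on $\mathcal{C}$).
   Context: Notation: $|\cdot|$ is the supremum norm on $\mathbb{R}^m$; $\|\cdot\|$ is the distance from a real number to the nearest integer. For a real $n\times m$ matrix $\Theta=(\Theta_{ij})$ and $q\in\mathbb{Z}^m$, put $\Theta_i(q)=\sum_{j=1}^m q_j\Theta_{ij}$ for $1\le i\le n$. $\mathrm{Bad}(\mathbf{k},n,m)$ is the set of $\Theta\in\mathrm{Mat}_{n\times m}(\mathbb{R})$ such that $\inf_{q\in\mathbb{Z}^m\setminus\{0\}}\max_{1\le i\le n}\big(|q|^{mk_i}\|\Theta_i(q)\|\big)>0$. For $\Theta\in\mathrm{Mat}_{n\times m}(\mathbb{R})$, $\mathrm{Bad}_\Theta(\mathbf{k},n,m)$ is the set of $x=(x_1,\ldots,x_n)\in\mathbb{R}^n$ such that $\inf_{q\in\mathbb{Z}^m\setminus\{0\}}\max_{1\le i\le n}\big(|q|^{mk_i}\|\Theta_i(q)-x_i\|\big)>0$. A $C^{(1)}$ curve in $\mathbb{R}^n$ is a set $\mathcal{C}=\{(f_1(x),\ldots,f_n(x)):x\in I\}$ where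 $f=(f_1,\ldots,f_n):I\to\mathbb{R}^n$ is a $C^{(1)}$ map on a compact interval $I\subset\mathbb{R}$ (of positive length). It is everywhere non-degenerate if for all $i=1,\ldots,n$ one has $f_i'(x)\ne 0$ for all $x\in I$. Schmidt's game on a complete metric space $(X,d)$ (here $X=\mathcal{C}$ with the metric induced from $\mathbb{R}^n$), with parameters $\alpha,\beta\in(0,1)$: balls are given by pairs $(x,\rho)$ with centre $x\in X$ and radius $\rho>0$, and $(x',\rho')$ is said to be contained in $(x,\rho)$ if $d(x,x')+\rho'\le\rho$. Bob first chooses a closed ball $B_0$ of arbitrary radius $\rho_0>0$. Then, alternately, Alice chooses a closed ball $A_s$ contained in $B_s$ of radius $\alpha$ times that of $B_s$, and Bob chooses a closed ball $B_{s+1}$ contained in $A_s$ of radius $\beta$ times that of $A_s$. The centres of the balls converge to a single point of $X$, the outcome. A set $S\subset X$ is $\alpha$-winning if for every $\beta\in(0,1)$ Alice has a strategy guaranteeing that the outcome lies in $S$; $S$ is winning if it is $\alpha$-winning for some $0<\alpha\le\frac12$. *)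

(* Defs.v *)
From HB Require Import structures.
From mathcomp Require Import all_boot all_order all_algebra.
From mathcomp Require Import all_classical all_reals all_analysis.
Import Order.TTheory GRing.Theory Num.Theory.
Import numFieldNormedType.Exports.

Set Implicit Arguments.
Unset Strict Implicit.
Unset Printing Implicit Defensive.

Local Open Scope classical_set_scope.
Local Open Scope ring_scope.

Definition dist_int {R : realType} (x : R) : R :=
  inf [set `|x - z%:~R| | z in [set: int]].

Definition lin_form {R : realType} {n m : nat} (Theta : 'M[R]_(n, m))
    (i : 'I_n) (q : 'rV[int]_m) : R :=
  \sum_(j < m) (q 0 j)%:~R * Theta i j.

(* The matrix norm of MathComp-Analysis is the supremum norm. *)
Definition int_norm {R : realType} {m : nat} (q : 'rV[int]_m) : R :=
  `|map_mx intr q : 'rV[R]_m|.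

(* The maxima below are over nonnegative reals, so the default value 0 is
   harmless; for m >= 1 the infima are over nonempty sets bounded below by 0. *)
Definition Bad {R : realType} {n m : nat} (k : 'I_n -> R) : set 'M[R]_(n, m) :=
  [set Theta | 0 < inf [set \big[Num.max/0]_(i < n)
      (int_norm q `^ (m%:R * k i) * dist_int (lin_form Theta i q))
    | q in [set q : 'rV[int]_m | q != 0]]].

Definition Bad_twisted {R : realType} {n m : nat} (k : 'I_n -> R)
    (Theta : 'M[R]_(n, m)) : set 'rV[R]_n :=
  [set x | 0 < inf [set \big[Num.max/0]_(i < n)
      (int_norm q `^ (m%:R * k i) * dist_int (lin_form Theta i q - x 0 i))
    | q in [set q : 'rV[int]_m | q != 0]]].

(* [g'] is the derivative of [g] on [a, b], one-sided at the endpoints. *)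
Definition is_derive_on {R : realType} (a b : R) (g g' : R -> R) : Prop :=
  forall x, x \in `[a, b] ->
    (fun y => (g y - g x) / (y - x)) @ within [set` `[a, b]] x^' --> g' x.

(* The values of [f] and [f'] outside [a, b] are irrelevant. *)
Definition everywhere_nondegenerate_C1_curve {R : realType} {n : nat}
    (C : set 'rV[R]_n) : Prop :=
  exists (a b : R) (f f' : 'I_n -> R -> R),
    [/\ a < b,
        C = [set \row_i f i x | x in [set` `[a, b]]],
        forall i, is_derive_on a b (f i) (f' i),
        forall i, {within [set` `[a, b]], continuous (f' i)}
      & forall i x, x \in `[a, b] -> f' i x != 0].

(* 'rV[R]_n comes with the supremum distance in MathComp-Analysis. *)
Definition euclidean_dist {R : realType} {n : nat} (x y : 'rV[R]_n) : R :=
  Num.sqrt (\sum_(i < n) (x 0 i - y 0 i) ^+ 2).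

(* Schmidt's game on a subset [X] of [T] with the metric induced by [d]; a ball
   is a pair (centre, radius) and not the corresponding set of points. *)
Section SchmidtGame.
Context {R : realType} {T : Type} (d : T -> T -> R) (X : set T).

Definition gball : Type := (T * R)%type.

Definition ball_in (B' B : gball) : Prop := d B.1 B'.1 + B'.2 <= B.2.

Definition legal_reply (c : R) (B B' : gball) : Prop :=
  [/\ X B'.1, ball_in B' B & B'.2 = c * B.2].

(* Alice's next ball as a function of the balls B_0, ..., B_s of Bob; her own
   earlier balls are determined by those. *)
Definition strategy : Type := seq gball -> gball.

Definition alice_ball (sigma : strategy) (B : nat -> gball) (s : nat) : gball :=
  sigma (mkseq B s.+1).

(* Bob's balls B_0, ..., B_s are legal when Alice follows [sigma]. *)
Definition bob_legal (beta : R) (sigma : strategy) (B : nat -> gball) (s : nat)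
    : Prop :=
  [/\ X (B 0%N).1, 0 < (B 0%N).2
    & forall j, (j < s)%N -> legal_reply beta (alice_ball sigma B j) (B j.+1)].

Definition outcome (B : nat -> gball) (x : T) : Prop :=
  X x /\ d (B s).1 x @[s --> \oo] --> (0 : R).

(* The first clause asks for legal replies at every finite stage, so that Alice
   cannot win by making a move after which Bob has no legal continuation. *)
Definition alice_wins_with (S : set T) (alpha beta : R) (sigma : strategy)
    : Prop :=
  (forall B s, bob_legal beta sigma B s ->
     legal_reply alpha (B s) (alice_ball sigma B s)) /\
  (forall B, (forall s, bob_legal beta sigma B s) ->
     exists2 x, outcome B x & S x).

Definition alpha_winning (S : set T) (alpha : R) : Prop :=
  forall beta, 0 < beta < 1 -> exists sigma, alice_wins_with S alpha beta sigma.

Definition winning (S : set T) : Prop :=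
  exists2 alpha, 0 < alpha <= 2^-1 & alpha_winning S alpha.

End SchmidtGame.

(* Main.v *)
Require Import Defs.
From mathcomp Require Import all_boot all_order all_algebra.
From mathcomp Require Import all_classical all_reals all_analysis.
From mathcomp Require Import ring lra zify.
Import Order.TTheory GRing.Theory Num.Theory.
Import numFieldNormedType.Exports.

Local Open Scope classical_set_scope.
Local Open Scope ring_scope.

(** Let k_(i0) be the largest weight.  Since Theta is in Bad, the points
    Theta(q) - p with |q| <= Q t are separated: a box with sides t^(-m k_i)
    contains at most N(Q) of them.  A ball of radius rho on the curve is
    contained in such a box for t = rho^(-1/(m k_(i0))), so at every turn only
    boundedly many new points with t <= |q| <= Q t come close to Bob's ball.  It
    is enough to keep away from them in the coordinate i0, where the curve is
    bi-Lipschitz to an interval.  Alice always has two replies so far apart that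
    no point is close to both, and takes the one with the smaller total weight
    of close points, where the weight of a point grows by 3/2 per turn.  The
    total weight then stays bounded, so each point is left behind within a
    bounded number L of turns, that is at a distance comparable to
    |q|^(-m k_(i0)). *)

(** * Schmidt's game with obstacles *)

Section Game.
Context {R : realType} {T : Type} (d : T -> T -> R) (X : set T).

(** As [d] is an arbitrary function here, positions are compared through real functions that are
    1-Lipschitz for [d], where the triangle inequality of [R] is at hand. *)
Definition nonexpansive (g : T -> R) := forall x y, `|g x - g y| <= d x y.

Lemma bob_radius (alpha beta : R) (sigma : strategy (R := R)) (B : nat -> gball) (s : nat) :
  0 < alpha -> 0 < beta ->
  (forall B s, bob_legal d X beta sigma B s ->
     legal_reply d X alpha (B s) (alice_ball sigma B s)) ->
  bob_legal d X beta sigma B s -> (B s).2 = (alpha * beta) ^+ s * (B 0%N).2.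
Proof.
move=> a0 b0 hA; elim: s => [|s IH] [XB B0 hB]; first by rewrite expr0 mul1r.
have hBs : bob_legal d X beta sigma B s.
  by split=> // j js; apply: hB; exact: ltnW.
have [_ _ ->] := hB s (ltnSn s); have [_ _ ->] := hA _ _ hBs.
by rewrite IH // exprS; ring.
Qed.

Lemma reply_nonexpansive (alpha beta : R) (g : T -> R) (B A B' : gball) :
  nonexpansive g -> legal_reply d X alpha B A -> legal_reply d X beta A B' ->
  `|g B.1 - g B'.1| + B'.2 <= B.2.
Proof.
move=> hg [_ h1 _] [_ h2 _]; rewrite /ball_in in h1 h2.
have := hg B.1 A.1; have := hg A.1 B'.1; have := ler_distD (g A.1) (g B.1) (g B'.1).
lra.
Qed.

End Game.

Lemma nested_dist {R : realType} (u r : nat -> R) :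
  (forall s, `|u s - u s.+1| + r s.+1 <= r s) ->
  forall s j, `|u s - u (s + j)%N| + r (s + j)%N <= r s.
Proof.
move=> h s; elim=> [|j IH]; first by rewrite addn0 subrr normr0 add0r.
rewrite addnS; have := h (s + j)%N.
by have := ler_distD (u (s + j)%N) (u s) (u (s + j).+1); lra.
Qed.

Section Avoidance.
Context {R : realType} {T : Type} (d : T -> T -> R) (X : set T) (g : T -> R).
(* obs B0 B are the values of g to be avoided from Bob's ball B on; they may
   depend on his first ball B0, whose radius is not under Alice's control. *)
Context (obs : @gball R T -> @gball R T -> seq R).

(* The factor 2 makes closeness inherited from a ball to any ball containing it,
   and leaves a margin of one radius around the ball. *)
Definition near_ball (A : @gball R T) (y : R) : bool :=
  `|y - g A.1| <= 2 * A.2.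

(* The potential of the game: a point produced at turn r has weight
   (3/2)^(s - r) at turn s, and only points close to A count. *)
Definition load (B : nat -> gball) (s : nat) (A : gball) : R :=
  \sum_(r < s.+1) (3 / 2) ^+ (s - r) * (count (near_ball A) (obs (B 0%N) (B r)))%:R.

Lemma near_ball_reply (c : R) (B A : gball) (y : R) : nonexpansive d g ->
  legal_reply d X c B A -> near_ball A y -> near_ball B y.
Proof.
move=> hg [_ hA _]; rewrite /near_ball /ball_in in hA *.
have := hg B.1 A.1; have := ler_distD (g A.1) y (g B.1).
rewrite (distrC (g B.1)).
(* Containment bounds the shift of centre by [B.2 - A.2] and forces [A.2 <= B.2], so adding
   [2 * A.2] gives at most [2 * B.2]. *)
by have : 0 <= `|g A.1 - g B.1| by []; lra.
Qed.

Lemma load_sub (B : nat -> gball) (s : nat) (A A' : gball) :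
  (forall y, near_ball A y -> near_ball A' y) -> load B s A <= load B s A'.
Proof.
move=> h; apply: ler_sum => r _; apply: ler_wpM2l; first by rewrite exprn_ge0 //; lra.
by rewrite ler_nat; exact: sub_count.
Qed.

(** No obstacle is counted twice on the left. Hence the lighter of two such balls carries at most
    half the load of [A]. *)
Lemma load_split (B : nat -> gball) (s : nat) (A1 A2 A : gball) :
  (forall y, near_ball A1 y -> near_ball A y) ->
  (forall y, near_ball A2 y -> near_ball A y) ->
  (forall y, near_ball A1 y -> near_ball A2 y -> False) ->
  load B s A1 + load B s A2 <= load B s A.
Proof.
move=> h1 h2 h; rewrite /load -big_split /=; apply: ler_sum => r _.
rewrite -mulrDr; apply: ler_wpM2l; first by rewrite exprn_ge0 //; lra.
rewrite -natrD ler_nat -count_predUI.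
rewrite [X in (_ + X)%N](_ : _ = 0%N) ?addn0; last first.
  by apply/eqP; rewrite -leqn0 leqNgt -has_count; apply/hasP => -[y _ /andP[/h] /[apply]].
by apply: sub_count => y /= /orP[/h1|/h2].
Qed.

Lemma loadS (B : nat -> gball) (s : nat) (A : gball) :
  load B s.+1 A = 3 / 2 * load B s A + (count (near_ball A) (obs (B 0%N) (B s.+1)))%:R.
Proof.
rewrite /load big_ord_recr /= subnn expr0 mul1r mulr_sumr; congr (_ + _).
apply: eq_bigr => r _; rewrite mulrA -exprS subSn //.
by rewrite -ltnS.
Qed.

Lemma eq_load (B B' : nat -> gball) (s : nat) (A : gball) :
  (forall r, (r <= s)%N -> B r = B' r) -> load B s A = load B' s A.
Proof.
by move=> h; apply: eq_bigr => r _; rewrite !h // -ltnS.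
Qed.

(** A single obstacle still close after [j] turns weighs this much alone, so a bounded load bounds
    [j]. *)
Lemma load_ge (B : nat -> gball) (s j : nat) (A : gball) (y : R) :
  y \in obs (B 0%N) (B s) -> near_ball A y -> (3 / 2) ^+ j <= load B (s + j) A.
Proof.
move=> hy hA; have hs : (s < (s + j).+1)%N by rewrite ltnS leq_addr.
rewrite /load (bigD1 (Ordinal hs)) //= addKn -[leLHS]addr0; apply: lerD.
  rewrite ler_peMr ?exprn_ge0 ?divr_ge0 //.
  by rewrite (ler_nat _ 1) -has_count; apply/hasP; exists y.
apply: sumr_ge0 => r _; apply: mulr_ge0 => //; apply: exprn_ge0; lra.
Qed.

(** The gap [4 * alpha * r] is twice the closeness range [2 * (alpha * r)] of Alice's balls, so her
    two candidates share no close point. The lag [L] may depend on the play, because [N] depends on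
    Bob's first ball. *)
Lemma avoidance_strategy (alpha beta rho : R) (N : gball -> nat) (x0 : T) :
  0 < alpha < 1 -> 0 < beta < 1 -> nonexpansive d g ->
  (forall x, X x -> d x x = 0) ->
  (forall x r, X x -> 0 < r <= rho -> exists x', [/\ X x',
     d x x' <= (1 - alpha) * r & 4 * alpha * r < `|g x - g x'|]) ->
  (forall B0 B, size (obs B0 B) <= N B0)%N ->
  (forall B0 B, rho < B.2 -> obs B0 B = [::]) ->
  exists sigma : strategy,
  (forall B s, bob_legal d X beta sigma B s ->
     legal_reply d X alpha (B s) (alice_ball sigma B s)) /\
  (forall B, (forall s, bob_legal d X beta sigma B s) -> exists L, forall s y,
     y \in obs (B 0%N) (B s) -> ~~ near_ball (B (s + L)%N) y).
Proof.
move=> /andP[a0 a1] /andP[b0 b1] hg dxx hX hN hobs.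
have /choice[esc hesc] (B : gball) : exists x', X B.1 -> 0 < B.2 <= rho ->
    [/\ X x', d B.1 x' <= (1 - alpha) * B.2 & 4 * alpha * B.2 < `|g B.1 - g x'|].
  have [[h1 h2]|h] := pselect (X B.1 /\ 0 < B.2 <= rho).
    by have [x' hx'] := hX _ _ h1 h2; exists x'.
  by exists B.1 => h1 h2; case: h.
pose stay (B : @gball R T) : @gball R T := (B.1, alpha * B.2).
pose move (B : @gball R T) : @gball R T := (esc B, alpha * B.2).
pose reply (B : nat -> @gball R T) s : @gball R T :=
  if (B s).2 <= rho then
    if load B s (stay (B s)) <= load B s (move (B s)) then stay (B s) else move (B s)
  else stay (B s).
(* Bob's latest ball has index [(size h).-1]. Histories in play are nonempty, so the default
   [(x0, 0)] is never read. *)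
pose sigma : strategy := fun h => reply (nth (x0, 0) h) (size h).-1.
have sigmaE B s : alice_ball sigma B s = reply B s.
  rewrite /alice_ball /sigma size_mkseq /= /reply !nth_mkseq //.
  by rewrite !(@eq_load (nth _ (mkseq B s.+1)) B) // => r rs; rewrite nth_mkseq.
have stay_legal B : X B.1 -> 0 < B.2 -> legal_reply d X alpha B (stay B).
  by move=> XB B0; split; rewrite // /ball_in dxx //= add0r ler_piMl ?ltW.
have move_legal B : X B.1 -> 0 < B.2 <= rho -> legal_reply d X alpha B (move B).
  by move=> XB B0; have [h1 h2 h3] := hesc _ XB B0; split; rewrite // /ball_in /=; lra.
have reply_legal B s : X (B s).1 -> 0 < (B s).2 ->
    legal_reply d X alpha (B s) (reply B s).
  move=> XB B0; rewrite /reply; case: ifP => h; last exact: stay_legal.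
  by case: ifP => _; [exact: stay_legal|apply: move_legal => //; rewrite B0].
have posB B s : bob_legal d X beta sigma B s -> X (B s).1 /\ 0 < (B s).2.
  elim: s => [|s IH] [XB B0 hB]; first by [].
  have [XBs Bs0] : X (B s).1 /\ 0 < (B s).2.
    by apply: IH; split=> // j js; apply: hB; exact: ltnW.
  have [XBS _ ->] := hB s (ltnSn s); split=> //.
  by rewrite sigmaE; have [_ _ ->] := reply_legal _ _ XBs Bs0; rewrite !mulr_gt0.
have hA B s : bob_legal d X beta sigma B s ->
    legal_reply d X alpha (B s) (alice_ball sigma B s).
  by move=> /posB[? ?]; rewrite sigmaE; exact: reply_legal.
exists sigma; split=> // B hB.
(* [4 * N] is the fixed point of [v |-> 3/2 * (v/2) + N]. *)
have hload s : load B s (B s) <= 4 * (N (B 0%N))%:R.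
  have cN s' A : (count (near_ball A) (obs (B 0%N) (B s')))%:R <= (N (B 0%N))%:R :> R.
    by rewrite ler_nat (leq_trans (count_size _ _)).
  have N0 : 0 <= (N (B 0%N))%:R :> R by [].
  elim: s => [|s IH].
    rewrite /load big_ord_recr big_ord0 /= add0r subnn expr0 mul1r.
    by have := cN 0%N (B 0%N); lra.
  have [XBs Bs0] := posB _ _ (hB s).
  have hr := reply_legal _ _ XBs Bs0.
  have hBS : legal_reply d X beta (reply B s) (B s.+1).
    by rewrite -sigmaE; have [_ _] := hB s.+1; apply.
  rewrite loadS.
  have := @load_sub B s _ _ (fun y => near_ball_reply _ _ _ y hg hBS).
  suff : load B s (reply B s) <= 2 * (N (B 0%N))%:R.
    by have := cN s.+1 (B s.+1); lra.
  rewrite /reply; have [hrho|hrho] := leP (B s).2 rho.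
    have hm : 0 < (B s).2 <= rho by rewrite Bs0.
    have [_ _ far] := hesc _ XBs hm.
    have := @load_split B s (stay (B s)) (move (B s)) (B s)
      (fun y => near_ball_reply _ _ _ y hg (stay_legal _ XBs Bs0))
      (fun y => near_ball_reply _ _ _ y hg (move_legal _ XBs hm)).
    have /[swap] /[apply] : forall y, near_ball (stay (B s)) y -> near_ball (move (B s)) y -> False.
      move=> y; rewrite /near_ball /= (distrC y (g (B s).1)) => h1 h2.
      have := ler_distD y (g (B s).1) (g (esc (B s))); lra.
    by case: (leP (load B s (stay (B s)))) => h1 h2; lra.
  (* Radii decrease, so every earlier ball also exceeds [rho] and has produced no obstacle. *)
  rewrite (_ : load _ _ _ = 0); first by lra.
  apply: big1 => r _; rewrite hobs /= ?mulr0 //.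
  rewrite (bob_radius _ _ _ _ _ _ _ a0 b0 hA (hB r)).
  rewrite (bob_radius _ _ _ _ _ _ _ a0 b0 hA (hB s)) in hrho.
  apply: (lt_le_trans hrho); rewrite ler_pM2r; last by have [] := posB _ _ (hB 0%N).
  by apply: ler_wiXn2l; [nra|nra|rewrite -ltnS].
have [L hL] : exists L, 4 * (N (B 0%N))%:R < (3 / 2) ^+ L :> R.
  have h : `|2 / 3 : R| < 1 by rewrite ger0_norm ?divr_ge0 //; lra.
  (* The added 1 keeps the inverse positive when [N] vanishes. *)
  have N0 : 0 < 4 * (N (B 0%N))%:R + 1 :> R by have : 0 <= (N (B 0%N))%:R :> R by []; lra.
  have e0 : 0 < (4 * (N (B 0%N))%:R + 1 : R)^-1 by rewrite invr_gt0.
  have /cvgrPdist_lt /(_ _ e0) [L _ /(_ L (leqnn _))] := cvg_expr h.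
  rewrite /= sub0r normrN ger0_norm ?exprn_ge0 ?divr_ge0 // => hL; exists L.
  rewrite -invf_div exprVn ltf_pV2 ?posrE ?exprn_gt0 ?divr_gt0 // in hL.
  lra.
exists L => s y hy; apply/negP => hn.
have := load_ge B s L (B (s + L)%N) y hy hn; have := hload (s + L)%N; lra.
Qed.
End Avoidance.

(** * Non-degenerate curves *)

(** Clearing the denominator brings in [y = x], which the punctured neighbourhood leaves out. *)
Lemma is_derive_on_dist {R : realType} (a b : R) (g g' : R -> R) (x e : R) :
  is_derive_on a b g g' -> x \in `[a, b] -> 0 < e -> exists2 r, 0 < r &
  forall y, y \in `[a, b] -> `|x - y| < r -> `|g y - g x - g' x * (y - x)| <= e * `|y - x|.
Proof.
move=> hg hx e0; have /cvgrPdist_lt /(_ e e0) := hg x hx.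
case=> r /= r0 h; exists r => // y hy hxy.
have [->|yx] := eqVneq y x; first by rewrite !subrr mulr0 subrr normr0 mulr0.
have yx0 : y - x != 0 by rewrite subr_eq0.
have /(_ hxy yx) := h y; rewrite /= => /(_ hy) /ltW.
rewrite -[X in _ -> X <= _]normrN -(ler_pM2r (_ : 0 < `|y - x|)) ?normr_gt0 // -normrM.
by congr (`|_| <= _); field.
Qed.

Lemma is_derive_on_continuous {R : realType} (a b c d : R) (g g' : R -> R) :
  is_derive_on a b g g' -> a <= c -> d <= b -> {within `[c, d], continuous g}.
Proof.
move=> hg ac db; apply/subspace_continuousP => x /=; rewrite in_itv /= => /andP[cx xd].
have hx : x \in `[a, b] by rewrite in_itv /=; apply/andP; split; lra.
apply/cvgrPdist_lt => e e0.
have [r r0 h] := is_derive_on_dist a b g g' x 1 hg hx ltr01.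
have K0 : 0 < 1 + `|g' x| by rewrite ltr_pwDl.
(* Near [x] the increment of [g] is at most [(1 + |g' x|) * |y - x|]. *)
exists (Num.min r (e / (1 + `|g' x|))) => /=; first by rewrite lt_min r0 divr_gt0.
move=> y /=; rewrite lt_min => /andP[yr ye]; rewrite in_itv /= => /andP[cy yd].
have hy : y \in `[a, b] by rewrite in_itv /=; apply/andP; split; lra.
have := h y hy yr; rewrite mul1r.
have := ler_normD (g y - g x - g' x * (y - x)) (g' x * (y - x)).
rewrite subrK normrM (distrC y x) (distrC (g x)); move: ye.
rewrite ltr_pdivlMr // mulrDr mulr1 (mulrC `|x - y|); lra.
Qed.

Lemma is_derive_on_is_derive {R : realType} (a b x : R) (g g' : R -> R) :
  is_derive_on a b g g' -> x \in `]a, b[ -> is_derive x 1 g (g' x).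
Proof.
move=> hg; rewrite in_itv /= => /andP[ax xb].
have hx : x \in `[a, b] by rewrite in_itv /= !ltW.
suff hc : (fun h => h^-1 *: ((g \o shift x) (h *: (1 : R)) - g x)) @ 0^' --> g' x.
  by apply: DeriveDef; [apply/cvg_ex; exists (g' x)|exact: cvg_lim hc].
apply/cvgrPdist_le => e e0; have [r r0 h] := is_derive_on_dist a b g g' x e hg hx e0.
exists (Num.min r (Num.min (x - a) (b - x))) => /=; first by rewrite !lt_min r0; lra.
move=> t /=; rewrite sub0r normrN !lt_min => /and3P[tr ta tb] t0.
have := ler_norm t; have := ler_norm (- t); rewrite normrN => h1 h2.
have htx : t + x \in `[a, b] by rewrite in_itv /=; apply/andP; split; lra.
have := h _ htx; rewrite (addrC t) opprD addrA subrr sub0r normrN addrC addrK => /(_ tr) h3.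
rewrite -(ler_pM2r (_ : 0 < `|t|)) ?normr_gt0 //; apply: le_trans h3.
rewrite -normrM -normrN le_eqVlt; apply/orP; left; apply/eqP.
by congr `|_|; rewrite /GRing.scale /= mulr1; field.
Qed.

Lemma is_derive_on_MVT {R : realType} (a b x y : R) (g g' : R -> R) :
  is_derive_on a b g g' -> x \in `[a, b] -> y \in `[a, b] ->
  exists2 c, c \in `[a, b] & g x - g y = g' c * (x - y).
Proof.
move=> hg; wlog yx : x y / y <= x => [hw hx hy|].
  have [yx|/ltW xy] := leP y x; first exact: hw.
  by have [c hc e] := hw y x xy hy hx; exists c => //; rewrite -opprB e; ring.
rewrite !in_itv /= => /andP[ax xb] /andP[ay yb].
have [||c] := @MVT_segment R g g' y x yx.
- move=> z; rewrite in_itv /= => /andP[yz zx].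
  by apply: (is_derive_on_is_derive a b) => //; rewrite in_itv /=; apply/andP; split; lra.
- exact: (is_derive_on_continuous _ _ _ _ _ _ hg).
rewrite in_itv /= => /andP[h1 h2] h; exists c => //.
by rewrite in_itv /=; apply/andP; split; lra.
Qed.

Lemma continuous_norm_bounds {R : realType} (a b : R) (h : R -> R) : a <= b ->
  {within `[a, b], continuous h} -> (forall x, x \in `[a, b] -> h x != 0) ->
  exists mu M, 0 < mu /\ forall x, x \in `[a, b] -> mu <= `|h x| <= M.
Proof.
move=> ab hc h0.
have hn : {within `[a, b], continuous (fun x => `|h x|)}.
  apply/subspace_continuousP => x hx; apply: cvg_norm.
  by move/subspace_continuousP : hc; exact.
have [c hc1 hc2] := EVT_min ab hn; have [e he1 he2] := EVT_max ab hn.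
exists `|h c|, `|h e|; split=> [|x hx]; first by rewrite normr_gt0 h0.
by rewrite hc2 ?he2.
Qed.

(** Mean value theorem, with [|g'|] between its extrema on the compact interval. Non-degeneracy
    enters here: it makes the minimum positive. *)
Lemma curve_bilipschitz {R : realType} (a b : R) (g g' : R -> R) : a < b ->
  is_derive_on a b g g' -> {within `[a, b], continuous g'} ->
  (forall x, x \in `[a, b] -> g' x != 0) ->
  exists mu M, 0 < mu /\ forall x y, x \in `[a, b] -> y \in `[a, b] ->
    mu * `|x - y| <= `|g x - g y| <= M * `|x - y|.
Proof.
move=> ab hg hc h0; have [mu [M [mu0 h]]] := continuous_norm_bounds a b g' (ltW ab) hc h0.
exists mu, M; split=> // x y hx hy.
have [c /h/andP[h1 h2] ->] := is_derive_on_MVT _ _ _ _ _ _ hg hx hy.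
by rewrite normrM !ler_wpM2r.
Qed.

Lemma cvg_of_radii {R : realType} (u r : nat -> R) :
  (forall s j, `|u s - u (s + j)%N| <= r s) -> r @ \oo --> 0 -> cvg (u @ \oo).
Proof.
move=> h hr; apply/cauchy_cvgP/cauchy_exP => e e0.
have /cvgrPdist_lt /(_ _ e0) [s _ /(_ s (leqnn s))] := hr.
rewrite /= sub0r normrN => hs; exists (u s), s => // n /= sn.
rewrite /ball /= -(subnKC sn); apply: le_lt_trans (h _ _) _.
by apply: le_lt_trans hs; exact: ler_norm.
Qed.

(** * Playing on a bi-Lipschitz curve *)

Section Curve.
Context {R : realType} {T : Type} (d : T -> T -> R) (phi : R -> T) (a b mu K : R) (g : T -> R).
Context (ab : a < b) (mu0 : 0 < mu) (hg : nonexpansive d g).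
Context (hmu : forall s t, s \in `[a, b] -> t \in `[a, b] ->
  mu * `|s - t| <= `|g (phi s) - g (phi t)|).
Context (hK : forall s t, s \in `[a, b] -> t \in `[a, b] ->
  d (phi s) (phi t) <= K * `|s - t|).
Let X := [set phi t | t in [set` `[a, b]]].

Lemma bilipschitz_constants_le : mu <= K.
Proof.
have ha : a \in `[a, b] by rewrite in_itv /= lexx ltW.
have hb : b \in `[a, b] by rewrite in_itv /= lexx ltW.
have ab0 : 0 < `|a - b| by rewrite normr_gt0 subr_eq0 lt_eqF.
rewrite -(ler_pM2r ab0); apply: le_trans (hmu _ _ ha hb) _.
exact: le_trans (hg _ _) (hK _ _ ha hb).
Qed.

Lemma curve_dist_refl (x : T) : X x -> d x x = 0.
Proof.
case=> t ht <-; apply/eqP; rewrite eq_le.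
have := hK _ _ ht ht; rewrite subrr normr0 mulr0 => -> /=.
by apply: le_trans (hg _ _); rewrite subrr normr0.
Qed.

(** Shift the parameter by [e = (1 - alpha) * r / K] towards the farther endpoint; the bound on [r]
    gives [e <= (b - a) / 2], so there is room. The upper bound [K] keeps the new ball legal, and
    [mu * e > 4 * alpha * r] is the hypothesis on [alpha]. *)
Lemma curve_escape (alpha : R) : 0 < alpha -> alpha * (mu + 4 * K) < mu ->
  forall x r, X x -> 0 < r <= K * (b - a) / 2 -> exists x', [/\ X x',
     d x x' <= (1 - alpha) * r & 4 * alpha * r < `|g x - g x'|].
Proof.
move=> al0 al x r [t /= ht <-] /andP[r0 hr]; have muK := bilipschitz_constants_le; have mu1 := mu0.
have K0 : 0 < K := lt_le_trans mu0 muK.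
have al1 : alpha < 1.
  have : alpha * mu < mu by apply: le_lt_trans al; rewrite ler_pM2l //; lra.
  by rewrite gtr_pMl.
pose e := (1 - alpha) * r / K.
have e0 : 0 < e by rewrite divr_gt0 // mulr_gt0 //; lra.
have he : e <= (b - a) / 2.
  rewrite ler_pdivrMr //; have : alpha * r > 0 by rewrite mulr_gt0.
  lra.
have [t' ht' tt'] : exists2 t', t' \in `[a, b] & `|t - t'| = e.
  move: ht; rewrite in_itv /= => /andP[h1 h2].
  have [h|h] := leP t ((a + b) / 2).
    exists (t + e); first by rewrite in_itv /=; apply/andP; split; lra.
    by rewrite opprD addrA subrr sub0r normrN gtr0_norm.
  exists (t - e); first by rewrite in_itv /=; apply/andP; split; lra.
  by rewrite opprB addrC subrK gtr0_norm.
exists (phi t'); split; first by exists t'.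
  by apply: le_trans (hK _ _ ht ht') _; rewrite tt' mulrC divfK // gt_eqF.
apply: lt_le_trans (hmu _ _ ht ht'); rewrite tt' /e mulrA ltr_pdivlMr //.
rewrite mulrA -subr_gt0 (_ : _ - _ = (mu - alpha * (mu + 4 * K)) * r); last by ring.
by rewrite mulr_gt0 // subr_gt0.
Qed.

(** The lower bound [mu] makes the parameters of the centres Cauchy, [[a, b]] contains their limit,
    and the upper bound [K] carries the convergence back to [d]. *)
Lemma play_outcome (rho : nat -> R) (x : nat -> T) :
  (forall s, X (x s)) -> rho @ \oo --> 0 ->
  (forall f, nonexpansive d f -> forall s, `|f (x s) - f (x s.+1)| + rho s.+1 <= rho s) ->
  (forall s, 0 <= rho s) ->
  exists y, [/\ X y, d (x s) y @[s --> \oo] --> 0 &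
    forall f, nonexpansive d f -> forall s, `|f (x s) - f y| <= rho s].
Proof.
move=> hX hrho hx rho0.
have hxj f : nonexpansive d f -> forall s j, `|f (x s) - f (x (s + j)%N)| <= rho s.
  move=> hf s j; have := nested_dist (f \o x) rho (hx f hf) s j.
  by have := rho0 (s + j)%N; rewrite /=; lra.
have /choice[t ht] s : exists t, t \in `[a, b] /\ phi t = x s.
  by have [t ? ?] := hX s; exists t.
have tcvg : cvg (t @ \oo).
  apply: (@cvg_of_radii _ _ (fun s => mu^-1 * rho s)).
    move=> s j; rewrite -(ler_pM2l mu0) mulrA divff ?gt_eqF // mul1r.
    have [h1 e1] := ht s; have [h2 e2] := ht (s + j)%N.
    by apply: le_trans (hmu _ _ h1 h2) _; rewrite e1 e2; exact: hxj.
  by rewrite -(mulr0 mu^-1); exact: cvgMl_tmp.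
set t0 := lim (t @ \oo) in tcvg.
have ht0 : t0 \in `[a, b].
  rewrite in_itv /=; apply/andP; split.
    apply: limr_ge => //; apply: nearW => s; have [] := ht s.
    by rewrite in_itv /= => /andP[].
  apply: limr_le => //; apply: nearW => s; have [] := ht s.
  by rewrite in_itv /= => /andP[].
have dge0 u v : 0 <= d u v by apply: le_trans (hg u v).
have hd : d (x s) (phi t0) @[s --> \oo] --> 0.
  apply: (@squeeze_cvgr _ _ _ _ (fun=> 0) (fun s => K * `|t s - t0|)).
  - apply: nearW => s; rewrite dge0 /=; have [h1 <-] := ht s; exact: hK.
  - exact: cvg_cst.
  rewrite -(mulr0 K); apply: cvgMl_tmp; rewrite -(normr0 R) -(subrr t0).
  by apply: cvg_norm; apply: cvgB => //; exact: cvg_cst.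
exists (phi t0); split=> //; first by exists t0.
move=> f hf s; apply/ler_addgt0Pr => e e0.
have /cvgrPdist_lt /(_ _ e0) [N _ /(_ (s + N)%N (leq_addl _ _))] := hd.
rewrite /= sub0r normrN ger0_norm // => h.
have := hxj _ hf s N; have := hf (x (s + N)%N) (phi t0).
by have := ler_distD (f (x (s + N)%N)) (f (x s)) (f (phi t0)); lra.
Qed.
End Curve.

(** * Separation of the values of badly approximable forms *)

Lemma dist_int_le {R : realType} (x : R) (z : int) : dist_int x <= `|x - z%:~R|.
Proof.
apply: ge_inf; last by exists z.
by exists 0 => _ [y _ <-].
Qed.

Lemma dist_int_lt {R : realType} (x e : R) : dist_int x < e -> exists z : int, `|x - z%:~R| < e.
Proof.
by move=> /inf_lt [|_ [z _ <-] hz]; [exists `|x - 0%:~R|, 0|exists z].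
Qed.

Section IntNorm.
Context {R : realType} {m : nat}.
Implicit Types q : 'rV[int]_m.
Local Notation int_norm := (@int_norm R m).

Lemma int_norm_ge0 q : 0 <= int_norm q.
Proof. exact: normr_ge0. Qed.

Lemma int_norm_ge1 q : q != 0 -> 1 <= int_norm q.
Proof.
move=> q0; have : (map_mx intr q : 'rV[R]_m) != 0.
  apply: contra q0 => /eqP h; apply/eqP/rowP => j; have /rowP/(_ j) := h.
  by rewrite !mxE => /eqP; rewrite intr_eq0 => /eqP.
rewrite -normr_eq0 => h; have := h => /mx_norm_neq0[[i j] e].
move: h; rewrite /int_norm /Num.norm /= e /= !mxE normr_eq0 intr_eq0 => h.
by rewrite -intr_norm -[1]/(1%:~R) ler_int; move: h; rewrite -normr_gt0; lia.
Qed.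

Lemma int_normB q q' : int_norm (q - q') <= int_norm q + int_norm q'.
Proof. by rewrite /int_norm map_mxB; exact: ler_normB. Qed.
End IntNorm.

Lemma lin_formB {R : realType} {n m : nat} (Theta : 'M[R]_(n, m)) (i : 'I_n) (q q' : 'rV[int]_m) :
  lin_form Theta i (q - q') = lin_form Theta i q - lin_form Theta i q'.
Proof.
by rewrite /lin_form -sumrB; apply: eq_bigr => j _; rewrite !mxE rmorphB /= mulrBl.
Qed.

Section Separation.
Context {R : realType} {n m : nat} (k : 'I_n -> R) (Theta : 'M[R]_(n, m)).

Lemma Bad_separation : Bad k Theta -> exists2 c, 0 < c &
  forall (q : 'rV[int]_m) (p : 'I_n -> int), q != 0 ->
    exists i, c <= int_norm q `^ (m%:R * k i) * `|lin_form Theta i q - (p i)%:~R|.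
Proof.
rewrite /Bad /=; set I := inf _ => I0; exists I => // q p q0.
have hI : I <= \big[Num.max/0]_(i < n)
      (int_norm q `^ (m%:R * k i) * dist_int (lin_form Theta i q)).
  apply: ge_inf; last by exists q.
  exists 0 => _ [y _ <-]; exact: bigmax_ge_id.
apply: contrapT => /forallNP h; move: hI; apply/negP; rewrite -ltNge.
apply: bigmax_lt => // i _; have := h i => /negP; rewrite -ltNge; apply: le_lt_trans.
by rewrite ler_wpM2l ?powR_ge0 // dist_int_le.
Qed.

Lemma Bad_twistedI (hm : (0 < m)%N) (x : 'rV[R]_n) (e : R) : 0 < e ->
  (forall (q : 'rV[int]_m) (p : 'I_n -> int), q != 0 ->
    exists i, e <= int_norm q `^ (m%:R * k i) * `|lin_form Theta i q - x 0 i - (p i)%:~R|) ->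
  Bad_twisted k Theta x.
Proof.
move=> e0 h; rewrite /Bad_twisted /=; apply: (lt_le_trans e0); apply: lb_le_inf.
  (* The infimum must range over a nonempty set; the all-ones vector is nonzero because [0 < m]. *)
  apply: image_nonempty; exists (const_mx 1) => /=.
  apply/negP => /eqP/rowP /(_ (Ordinal hm)); rewrite !mxE => /eqP.
  by rewrite oner_eq0.
move=> _ [q /= q0 <-]; rewrite leNgt; apply/negP => hlt.
have /choice[p hp] (i : 'I_n) : exists p : int,
    int_norm q `^ (m%:R * k i) * `|lin_form Theta i q - x 0 i - p%:~R| < e.
  have Q0 : 0 < int_norm q `^ (m%:R * k i) :> R.
    by rewrite powR_gt0 // (lt_le_trans ltr01) // int_norm_ge1.
  have : int_norm q `^ (m%:R * k i) * dist_int (lin_form Theta i q - x 0 i) < e.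
    by apply: le_lt_trans hlt; exact: le_bigmax.
  rewrite mulrC -ltr_pdivlMr // => /dist_int_lt[p hp]; exists p.
  by rewrite mulrC -ltr_pdivlMr.
by have [i] := h q p q0; rewrite leNgt hp.
Qed.
End Separation.

(** Pigeonhole: cut the cube [[-D, D]^n] into cells of side [eta]. Two points of one cell differ by
    less than [eta] in every coordinate, so each cell holds at most one. The number of cells is
    fixed before the family is given. *)
Lemma separated_list {R : realType} (n : nat) (eta D : R) : 0 < eta ->
  exists N : nat, forall (J : choiceType) (j0 : J) (A : set J) (z : J -> 'I_n -> R),
    (forall j i, A j -> `|z j i| <= D) ->
    (forall j j', A j -> A j' -> j != j' -> exists i, eta <= `|z j i - z j' i|) ->
    exists2 l : seq J, (size l <= N)%N & forall j, A j -> j \in l.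
Proof.
move=> eta0; set M := Num.truncn (2 * D / eta).
exists #|{ffun 'I_n -> 'I_M.+1}| => J j0 A z hD hsep.
pose key j : {ffun 'I_n -> 'I_M.+1} := [ffun i => inord (Num.truncn ((z j i + D) / eta))].
have hb j i : A j -> 0 <= (z j i + D) / eta.
  move=> Aj; apply: divr_ge0; last exact: ltW.
  by have := hD j i Aj; rewrite ler_norml; lra.
have hM j i : A j -> (Num.truncn ((z j i + D) / eta) < M.+1)%N.
  move=> Aj; rewrite ltnS; apply: le_truncn; rewrite ler_pM2r ?invr_gt0 //.
  by have := hD j i Aj; rewrite ler_norml; lra.
have key_inj j j' : A j -> A j' -> key j = key j' -> j = j'.
  move=> Aj Aj' /ffunP e; apply/eqP/negPn/negP => /(hsep _ _ Aj Aj')[i].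
  have := e i; rewrite !ffunE => /(congr1 val); rewrite /= !inordK ?hM // => et.
  have /andP[] := truncn_itv (hb j i Aj); have /andP[] := truncn_itv (hb j' i Aj').
  rewrite et -!natr1 => h1 h2 h3 h4; apply/negP; rewrite -ltNge.
  have : `|(z j i + D) / eta - (z j' i + D) / eta| < 1 by rewrite ltr_norml; lra.
  rewrite -mulrBl normrM (gtr0_norm (_ : 0 < eta^-1)) ?invr_gt0 //.
  rewrite ltr_pdivrMr // mul1r; congr (`|_| < _); ring.
(* [s] inverts [key] on [A]; empty cells get the default [j0]. *)
have /choice[s hs] (c : {ffun 'I_n -> 'I_M.+1}) : exists j, forall j', A j' -> key j' = c -> j' = j.
  have [[j [Aj kj]]|h] := pselect (exists j, A j /\ key j = c).
    by exists j => j' Aj' kj'; apply: key_inj => //; rewrite kj kj'.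
  by exists j0 => j' Aj' kj'; case: h; exists j'.
exists (map s (enum {ffun 'I_n -> 'I_M.+1})); first by rewrite size_map cardE.
by move=> j Aj; apply/mapP; exists (key j); [rewrite mem_enum|exact: hs].
Qed.

(** Rescaling coordinate [i] by [t^(m k_i)] turns the box into a cube. For [q != q'], badness at
    [q - q'], of norm at most [2 * Q * t], separates the rescaled points by [c / (2 * Q)^m], since
    [k i <= 1]. For [q = q'] some integers [p i] differ, which gives separation 1 since [1 <= t].
    Neither bound depends on [t] or [x]. *)
Lemma near_points_list {R : realType} {n m : nat} (k : 'I_n -> R) (Theta : 'M[R]_(n, m))
    (i0 : 'I_n) (Q : R) :
  (forall i, 0 < k i <= 1) -> Bad k Theta -> 1 <= Q -> exists N : nat,
  forall (t : R) (x : 'rV[R]_n), 1 <= t -> exists2 l : seq R, (size l <= N)%N &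
  forall (q : 'rV[int]_m) (p : 'I_n -> int), int_norm q <= Q * t ->
    (forall i, t `^ (m%:R * k i) * `|x 0 i - (lin_form Theta i q - (p i)%:~R)| <= 2) ->
    lin_form Theta i0 q - (p i0)%:~R \in l.
Proof.
move=> hk /Bad_separation[c c0 hc] Q1.
have W0 : 0 < (2 * Q) `^ m%:R by rewrite powR_gt0 //; lra.
pose eta := Num.min 1 (c / (2 * Q) `^ m%:R).
have eta0 : 0 < eta by rewrite lt_min ltr01 divr_gt0.
have [N hN] := @separated_list R n eta 2 eta0.
exists N => t x t1.
(* Integer shifts are stored as finite functions so that the index type is a [choiceType]. *)
pose P (j : 'rV[int]_m * {ffun 'I_n -> int}) i := lin_form Theta i j.1 - (j.2 i)%:~R.
pose z j i := t `^ (m%:R * k i) * (x 0 i - P j i).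
pose A := [set j | int_norm j.1 <= Q * t /\ forall i, `|z j i| <= 2].
have mk0 i : 0 <= m%:R * k i by rewrite mulr_ge0 // ltW //; have /andP[] := hk i.
have zB j j' i : `|z j i - z j' i| = t `^ (m%:R * k i) * `|P j i - P j' i|.
  rewrite /z -mulrBr normrM (ger0_norm (powR_ge0 _ _)) (distrC (P j i)).
  by congr (_ * `|_|); ring.
have [| |l hl1 hl2] := hN _ (0, [ffun=> 0]) A z.
- by move=> j i [].
- move=> [q p] [q' p'] [/= h1 _] [/= h2 _] ne.
  have [eq|qq'] := eqVneq q q'.
    have [i hi] : exists i, p i != p' i.
      apply: contrapT => /forallNP h; move: ne; rewrite eq xpair_eqE eqxx /=; apply/negP/negPn/eqP.
      by apply/ffunP => i; apply/eqP/negPn/negP; exact: h.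
    exists i; rewrite ge_min zB; apply/orP; left.
    rewrite -[leLHS]mulr1; apply: ler_pM => //.
      have : 1 `^ (m%:R * k i) <= t `^ (m%:R * k i).
        by apply: ge0_ler_powR; rewrite ?nnegrE //; lra.
      by rewrite powR1.
    rewrite /P /= eq opprB addrC addrA subrK -intrB -intr_norm -[1]/(1%:~R) ler_int.
    by rewrite -gtz0_ge1 normr_gt0 subr_eq0 eq_sym.
  have qq0 : q - q' != 0 by rewrite subr_eq0.
  have [i hi] := hc _ (fun i => p i - p' i) qq0.
  exists i; rewrite ge_min zB; apply/orP; right; rewrite ler_pdivrMr //.
  apply: (le_trans hi); rewrite lin_formB intrB.
  rewrite (_ : _ - (_ - _) = P (q, p) i - P (q', p') i); last by rewrite /P /=; ring.
  rewrite mulrAC ler_wpM2r //.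
  apply: (@le_trans _ _ ((2 * Q * t) `^ (m%:R * k i))).
    apply: ge0_ler_powR; rewrite ?nnegrE ?int_norm_ge0 //; first by nra.
    by apply: le_trans (int_normB _ _) _; lra.
  rewrite powRM; [|lra|lra]; rewrite mulrC ler_wpM2l ?powR_ge0 //.
  apply: ler_powR; first lra.
  by rewrite ler_piMr //; have /andP[] := hk i.
exists [seq P j i0 | j <- l]; first by rewrite size_map.
move=> q p hq hp; apply/mapP; exists (q, [ffun i => p i]); last by rewrite /P /= ffunE.
apply: hl2; split=> // i; rewrite /z normrM (ger0_norm (powR_ge0 _ _)) /P /= ffunE.
exact: hp.
Qed.

(** * Heights and radii *)

Section Scale.
Context {R : realType} (kappa : R) (kappa0 : 0 < kappa).

(* The height at which dangerous points are as wide as a ball of radius rho. *)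
Definition scale (rho : R) : R := rho `^ (- kappa^-1).

Lemma scaleK (rho : R) : 0 < rho -> scale rho `^ kappa = rho^-1.
Proof.
by move=> r0; rewrite /scale -powRrM mulNr mulVf ?gt_eqF // powRN powRr1 // ltW.
Qed.

Lemma scale_powK (y : R) : 0 < y -> scale (y `^ kappa)^-1 = y.
Proof.
move=> y0; rewrite /scale -powRN -powRrM mulrNN mulfV ?gt_eqF // powRr1 //.
exact: ltW.
Qed.

Lemma scale_le (u v : R) : 0 < u -> u <= v -> scale v <= scale u.
Proof.
move=> u0 uv; have v0 := lt_le_trans u0 uv.
rewrite /scale !powRN lef_pV2 ?posrE ?powR_gt0 //.
by apply: ge0_ler_powR; rewrite ?nnegrE ?invr_ge0 // ltW.
Qed.

Lemma scaleM (u v : R) : 0 <= u -> 0 <= v -> scale (u * v) = scale u * scale v.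
Proof. by move=> u0 v0; rewrite /scale powRM. Qed.

Lemma scale_ge1 (u : R) : 0 < u <= 1 -> 1 <= scale u.
Proof.
by move=> /andP[u0 u1]; have := scale_le _ _ u0 u1; rewrite {1}/scale powR1.
Qed.
End Scale.

Lemma sum_sqr_le {R : realType} (n : nat) (u : 'I_n -> R) :
  Num.sqrt (\sum_i u i ^+ 2) <= \sum_i `|u i|.
Proof.
have [h1 h2] : 0 <= \sum_i `|u i| /\ \sum_i u i ^+ 2 <= (\sum_i `|u i|) ^+ 2.
  pose P (v w : R) := 0 <= w /\ v <= w ^+ 2.
  apply: (big_ind2 (fun w v => P v w)); rewrite /P.
  - by rewrite expr0n.
  - by move=> x1 x2 y1 y2 [? ?] [? ?]; split; [exact: addr_ge0|nra].
  - by move=> i _; rewrite real_normK ?num_real.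
by rewrite -(ger0_norm h1) -sqrtr_sqr ler_sqrt // sqr_ge0.
Qed.

Lemma coord_nonexpansive {R : realType} (n : nat) (i : 'I_n) :
  nonexpansive (@euclidean_dist R n) (fun x => x 0 i).
Proof.
move=> x y; rewrite /euclidean_dist -sqrtr_sqr ler_sqrt; last first.
  by apply: sumr_ge0 => j _; exact: sqr_ge0.
by rewrite (bigD1 i) //= lerDl; apply: sumr_ge0 => j _; exact: sqr_ge0.
Qed.

Lemma exists_max {R : realType} (n : nat) (k : 'I_n -> R) :
  (0 < n)%N -> exists i0, forall i, k i <= k i0.
Proof.
case: n k => // n k _; exists [arg max_(i > ord0) k i]%O.
by case: arg_maxP => // i _ h j; exact: h.
Qed.

Lemma shrinking_scale {R : realType} (theta r e : R) : 0 < theta < 1 -> 0 < e ->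
  exists s, theta ^+ s * r <= e.
Proof.
move=> /andP[t0 t1] e0.
have h : (fun s => theta ^+ s * r) @ \oo --> 0.
  rewrite -(mul0r r); apply: cvgMr_tmp; apply: cvg_expr.
  by rewrite ger0_norm // ltW.
have /cvgrPdist_lt /(_ _ e0) [s _ /(_ s (leqnn s))] := h.
rewrite /= sub0r normrN => hs; exists s.
by apply: ltW; apply: le_lt_trans hs; exact: ler_norm.
Qed.

(** Makes the list a function of height and centre, as the obstacles of the game must be; it is
    empty where [1 <= Q] or [1 <= t] fails. *)
Lemma uniform_lists {R : realType} {n m : nat} (k : 'I_n -> R) (Theta : 'M[R]_(n, m))
    (i0 : 'I_n) (Q : R) : (forall i, 0 < k i <= 1) -> Bad k Theta ->
  exists (N : nat) (l : R -> 'rV[R]_n -> seq R), forall t x,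
  (size (l t x) <= N)%N /\ (1 <= Q -> 1 <= t ->
  forall (q : 'rV[int]_m) (p : 'I_n -> int), int_norm q <= Q * t ->
    (forall i, t `^ (m%:R * k i) * `|x 0 i - (lin_form Theta i q - (p i)%:~R)| <= 2) ->
    lin_form Theta i0 q - (p i0)%:~R \in l t x).
Proof.
move=> hk hTheta; have [Q1|Q1] := leP 1 Q; last first.
  by exists 0%N, (fun _ _ => [::]) => t x; split.
have [N hN] := near_points_list k Theta i0 Q hk hTheta Q1.
have /choice[l hl] (tx : R * 'rV[R]_n) : exists l : seq R, (size l <= N)%N /\ (1 <= tx.1 ->
  forall (q : 'rV[int]_m) (p : 'I_n -> int), int_norm q <= Q * tx.1 ->
    (forall i, tx.1 `^ (m%:R * k i) * `|tx.2 0 i - (lin_form Theta i q - (p i)%:~R)| <= 2) ->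
    lin_form Theta i0 q - (p i0)%:~R \in l).
  case: tx => t x /=; have [t1|t1] := leP 1 t; last by exists [::].
  by have [l h1 h2] := hN t x t1; exists l.
by exists N, (fun t x => l (t, x)) => t x; have [h1 h2] := hl (t, x); split.
Qed.

(* l1 s lists the points near Bob's s-th ball with height up to that of the next
   ball; l2 s lists those of height below an initial threshold, which are never
   reached by l1 at a stage where the ball is small enough to be played on. *)
Section Outcome.
Context {R : realType} {n m : nat} (k : 'I_n -> R) (Theta : 'M[R]_(n, m)) (i0 : 'I_n).
Context (hm : (0 < m)%N) (hk : forall i, 0 < k i) (hk0 : forall i, k i <= k i0).
Context (theta rho0 r1 : R) (th : 0 < theta < 1) (rho00 : 0 < rho0) (r10 : 0 < r1 <= 1).
Context (L : nat) (x : nat -> 'rV[R]_n) (y : 'rV[R]_n) (l1 l2 : nat -> seq R).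
Let kappa := m%:R * k i0.
Let rho s := theta ^+ s * rho0.
Let P (q : 'rV[int]_m) (p : 'I_n -> int) i := lin_form Theta i q - (p i)%:~R.

(** A violating [q] of large height satisfies [scale (rho s) < |q| <= scale (rho s.+1)] for some
    [s]. Its point is then in [l1 s], hence ends up farther than [theta^L * rho s] from [y] in
    coordinate [i0], while [|q|^kappa >= 1 / rho s]. *)
Lemma outcome_bad :
  (forall s i, `|x s 0 i - y 0 i| <= rho s) ->
  (forall s z, rho s <= r1 -> z \in l1 s ++ l2 s -> 2 * rho (s + L)%N < `|z - x (s + L)%N 0 i0|) ->
  (forall s (q : 'rV[int]_m) (p : 'I_n -> int), rho s <= r1 ->
    int_norm q <= scale kappa theta * scale kappa (rho s) ->
    (forall i, scale kappa (rho s) `^ (m%:R * k i) * `|x s 0 i - P q p i| <= 2) ->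
    P q p i0 \in l1 s) ->
  (forall s (q : 'rV[int]_m) (p : 'I_n -> int), rho s <= r1 ->
    int_norm q <= scale kappa (Num.min rho0 (theta * r1)) ->
    (forall i, `|x s 0 i - P q p i| <= 2) -> P q p i0 \in l2 s) ->
  Bad_twisted k Theta y.
Proof.
move=> hxy havoid hl1 hl2.
have /andP[th0 th1] := th; have /andP[r1_0 r1_1] := r10.
have m0 : 0 < m%:R :> R by rewrite ltr0n.
have kappa0 : 0 < kappa by rewrite mulr_gt0.
have mk0 i : 0 <= m%:R * k i := mulr_ge0 (ltW m0) (ltW (hk i)).
have rhop s : 0 < rho s by rewrite mulr_gt0 // exprn_gt0.
have rhoS s : rho s.+1 = theta * rho s by rewrite /rho exprS mulrA.
have rhoD s j : rho (s + j)%N = theta ^+ j * rho s by rewrite /rho addnC exprD mulrA.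
have [s0 hs0] := shrinking_scale theta rho0 r1 th r1_0.
have tL : 0 < theta ^+ L by rewrite exprn_gt0.
(* The three terms serve, in order, closeness to the centres, the large heights and the heights
   below the threshold. *)
pose e := Num.min 1 (Num.min (theta ^+ L) (theta ^+ L * rho s0)).
have e0 : 0 < e by rewrite !lt_min ltr01 tL mulr_gt0.
have e1 : e <= 1 by rewrite ge_min lexx.
have e2 : e <= theta ^+ L by rewrite !ge_min lexx !orbT.
have e3 : e <= theta ^+ L * rho s0 by rewrite !ge_min lexx !orbT.
apply: (@Bad_twistedI _ _ _ _ _ hm _ e e0) => q p q0.
apply: contrapT => /forallNP h.
have {}h i : int_norm q `^ (m%:R * k i) * `|y 0 i - P q p i| < e.
  have /negP := h i; rewrite -ltNge; congr (_ * _ < _).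
  by rewrite /P -normrN; congr (`|_|); ring.
have q1 : 1 <= int_norm q :> R := int_norm_ge1 q q0.
(* Of the two radii of margin at turn [s + L], one is lost in passing from the centre to [y]. *)
have far s : rho s <= r1 -> P q p i0 \in l1 s ++ l2 s ->
    theta ^+ L * rho s < `|y 0 i0 - P q p i0|.
  move=> hs /havoid => /(_ hs); rewrite -rhoD => h1.
  have := ler_distD (y 0 i0) (P q p i0) (x (s + L)%N 0 i0).
  by have := hxy (s + L)%N i0; rewrite !(distrC (y 0 i0)) (distrC (x _ _ _)); lra.
have qpow i : 1 <= int_norm q `^ (m%:R * k i) :> R.
  by rewrite -[leLHS](powRr0 (int_norm q)); apply: ler_powR; rewrite ?mk0.
have yP i : `|y 0 i - P q p i| <= e.
  by apply: le_trans (ltW (h i)); rewrite ler_peMl.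
have near s i : `|x s 0 i - P q p i| <= rho s + `|y 0 i - P q p i|.
  by have := ler_distD (y 0 i) (x s 0 i) (P q p i); have := hxy s i; lra.
(* Above this threshold, [rho0] excludes that the first admissible index is 0, and [theta * r1]
   ensures that the preceding ball has radius at most [r1]. *)
have [hq|hq] := leP (int_norm q) (scale kappa (Num.min rho0 (theta * r1))).
  have hin : P q p i0 \in l2 s0.
    by apply: hl2 => // i; have := near s0 i; have := yP i; rewrite -/(rho s0) in hs0; lra.
  have := far s0 hs0; rewrite mem_cat hin orbT => /(_ isT).
  by have := yP i0; lra.
have ex : exists s, int_norm q <= scale kappa (rho s).
  have qk0 : 0 < (int_norm q `^ kappa)^-1 :> R by rewrite invr_gt0 powR_gt0 //; lra.
  have [s hs] := shrinking_scale theta rho0 _ th qk0; exists s.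
  rewrite -[leLHS](scale_powK _ kappa0); last by lra.
  exact: scale_le.
case: (ex_minnP ex) => -[|s] hs hmin.
  have := scale_le _ kappa0 (Num.min rho0 (theta * r1)) (rho 0%N).
  rewrite lt_min rho00 mulr_gt0 // ge_min {1 2}/rho expr0 mul1r lexx => /(_ isT isT).
  move: hs; rewrite /rho expr0 mul1r; lra.
have hs' : scale kappa (rho s) < int_norm q.
  by rewrite ltNge; apply/negP => /hmin; rewrite ltnn.
have rs : rho s <= r1.
  rewrite leNgt; apply/negP => hr.
  have := scale_le _ kappa0 (Num.min rho0 (theta * r1)) (rho s.+1).
  rewrite lt_min rho00 mulr_gt0 // rhoS ge_min ler_pM2l // (ltW hr) orbT => /(_ isT isT).
  by rewrite -rhoS; lra.
have T1 : 1 <= scale kappa (rho s) by apply: scale_ge1 => //; rewrite rhop (le_trans rs).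
have Tk : scale kappa (rho s) `^ kappa * rho s = 1.
  by rewrite scaleK // mulVf // gt_eqF.
have hin : P q p i0 \in l1 s.
  apply: hl1 => //; first by rewrite -scaleM ?(ltW th0) ?(ltW (rhop s)) // -rhoS.
  move=> i.
  have T0 : 0 <= scale kappa (rho s) `^ (m%:R * k i) by rewrite powR_ge0.
  (* As [k i <= k i0] and the scale is at least 1, coordinate [i0] has the narrowest side of the
     box. *)
  have h1 : scale kappa (rho s) `^ (m%:R * k i) * rho s <= 1.
    rewrite -[leRHS]Tk ler_pM2r //; apply: ler_powR => //.
    by rewrite /kappa ler_wpM2l // ltW.
  have h2 : scale kappa (rho s) `^ (m%:R * k i) * `|y 0 i - P q p i| <= 1.
    apply: le_trans e1; apply: le_trans (ltW (h i)); rewrite ler_wpM2r //.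
    apply: ge0_ler_powR; rewrite ?nnegrE ?(ltW hs') //.
    - by lra.
    - by lra.
  apply: (@le_trans _ _ (scale kappa (rho s) `^ (m%:R * k i) * (rho s + `|y 0 i - P q p i|))).
    by rewrite ler_wpM2l.
  by rewrite mulrDr; lra.
have := far s rs; rewrite mem_cat hin => /(_ isT) h1.
have : scale kappa (rho s) `^ kappa * (theta ^+ L * rho s) < e.
  apply: le_lt_trans (h i0); apply: ler_pM; rewrite ?powR_ge0 //.
  - by rewrite mulr_ge0 // ltW.
  - by apply: ge0_ler_powR; rewrite ?nnegrE ?(ltW hs') ?(ltW kappa0) //; lra.
  - exact: ltW.
by rewrite mulrCA Tk mulr1; lra.
Qed.
End Outcome.

(** * Assembling the strategy on the curve *)

Lemma curve_parametrization {R : realType} {n : nat} (C : set 'rV[R]_n) (i0 : 'I_n) :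
  everywhere_nondegenerate_C1_curve C ->
  exists (a b mu K : R) (phi : R -> 'rV[R]_n), [/\ a < b, 0 < mu,
    C = [set phi t | t in [set` `[a, b]]],
    forall s t, s \in `[a, b] -> t \in `[a, b] ->
      mu * `|s - t| <= `|phi s 0 i0 - phi t 0 i0| &
    forall s t, s \in `[a, b] -> t \in `[a, b] ->
      euclidean_dist (phi s) (phi t) <= K * `|s - t|].
Proof.
move=> [a [b [f [f' [ab -> hder hcont hne]]]]].
have /choice[muM hmuM] (i : 'I_n) : exists muM : R * R, 0 < muM.1 /\
    forall s t, s \in `[a, b] -> t \in `[a, b] ->
    muM.1 * `|s - t| <= `|f i s - f i t| <= muM.2 * `|s - t|.
  have [mu [M h]] := curve_bilipschitz a b (f i) (f' i) ab (hder i) (hcont i) (hne i).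
  by exists (mu, M).
(* The Euclidean norm is at most the sum of the coordinates, so the Lipschitz constants add up. *)
exists a, b, (muM i0).1, (\sum_i (muM i).2), (fun t => \row_i f i t); split=> //.
- by have [] := hmuM i0.
- move=> s t hs ht; rewrite !mxE.
  by have [_ /(_ s t hs ht) /andP[]] := hmuM i0.
move=> s t hs ht; apply: le_trans (sum_sqr_le _ _) _; rewrite mulr_suml.
apply: ler_sum => i _; rewrite !mxE.
by have [_ /(_ s t hs ht) /andP[]] := hmuM i.
Qed.

Theorem theorem2p1 (R : realType) (n m : nat) (hn : (1 <= n)%N) (hm : (1 <= m)%N)
    (k : 'I_n -> R) (hk : forall i, 0 < k i) (hk1 : \sum_(i < n) k i = 1)
    (Theta : 'M[R]_(n, m)) (hTheta : Bad k Theta)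
    (C : set 'rV[R]_n) (hC : everywhere_nondegenerate_C1_curve C) :
  winning euclidean_dist C (Bad_twisted k Theta `&` C).
Proof.
have hk01 i : 0 < k i <= 1.
  by rewrite hk -hk1 (bigD1 i) //= lerDl; apply: sumr_ge0 => j _; exact: ltW.
have [i0 hi0] := exists_max n k hn.
have [a [b [mu [K [phi [ab mu0 CE hmu hK]]]]]] := curve_parametrization C i0 hC.
have hg : nonexpansive (@euclidean_dist R n) (fun x => x 0 i0) := coord_nonexpansive n i0.
have muK : mu <= K := bilipschitz_constants_le _ _ _ _ _ _ _ ab hg hmu hK.
have K0 : 0 < K := lt_le_trans mu0 muK.
(* Half the critical value in [curve_escape], chosen before [beta]. *)
pose alpha := mu / (mu + 4 * K) / 2.
have S0 : 0 < mu + 4 * K by lra.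
have alpha0 : 0 < alpha by rewrite /alpha !divr_gt0.
have alphaS : alpha * (mu + 4 * K) = mu / 2 by rewrite /alpha; field; rewrite gt_eqF.
have alpha2 : alpha <= 2^-1.
  by rewrite -(ler_pM2r S0) alphaS; lra.
have m0 : 0 < m%:R :> R by rewrite ltr0n.
pose kappa : R := m%:R * k i0.
have kappa0 : 0 < kappa by rewrite mulr_gt0.
(* The bound 1 keeps scales at least 1; the other one leaves room to escape. *)
pose r1 := Num.min 1 (K * (b - a) / 2).
have r10 : 0 < r1 <= 1.
  by rewrite lt_min ltr01 ge_min lexx /= andbT !mulr_gt0 ?invr_gt0 ?subr_gt0.
have /andP[r1_0 r1_1] := r10.
exists alpha; first by rewrite alpha0 alpha2.
move=> beta hbeta; have /andP[b0 b1] := hbeta.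
have alpha1 : alpha < 1 by lra.
pose theta := alpha * beta.
have th : 0 < theta < 1 by rewrite mulr_gt0 //= mulr_ilt1 // ltW.
have /andP[th0 th1] := th.
pose t := scale kappa.
pose Q (rho0 : R) := t (Num.min rho0 (theta * r1)).
(* [N] and [l] are functions of [Q] because the threshold for small heights depends on Bob's first
   radius. *)
have [N hN] := choice (fun Q => uniform_lists k Theta i0 Q hk01 hTheta).
have [l hl] := choice hN.
(* The first list covers heights up to that of Bob's next ball. The second takes [t = 1], where the
   box is a cube of fixed size, and covers the heights below the threshold. *)
pose obs (B0 B : @gball R 'rV[R]_n) : seq R := if B.2 <= r1
  then l (t theta) (t B.2) B.1 ++ l (Q B0.2) 1 B.1 else [::].
have [|||||sigma [hleg havoid]] := @avoidance_strategy R _ euclidean_dist C (fun x => x 0 i0)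
    obs alpha beta r1 (fun B0 => N (t theta) + N (Q B0.2))%N 0 _ hbeta hg.
- by rewrite alpha0.
- by rewrite CE; apply: (curve_dist_refl _ _ _ _ _ _ hg hK).
- move=> x r Cx /andP[r0 hr].
  have h := curve_escape _ phi a b mu K _ ab mu0 hg hmu hK alpha alpha0.
  rewrite CE; apply: h; [by rewrite alphaS; lra|by rewrite -CE|].
  by rewrite r0 (le_trans hr) // ge_min lexx orbT.
- move=> B0 B; rewrite /obs; case: ifP => // _; rewrite size_cat.
  by apply: leq_add; exact: (hl _ _ _).1.
- by move=> B0 B; rewrite /obs ltNge => /negbTE ->.
exists sigma; split=> // B hB.
have CB s : C (B s).1.
  by case: s => [|s]; [have [] := hB 0%N|have [_ _ /(_ s (ltnSn s))[]] := hB s.+1].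
have rhoE s : (B s).2 = theta ^+ s * (B 0%N).2.
  exact: (bob_radius euclidean_dist C alpha beta sigma B s alpha0 b0 hleg (hB s)).
have rho00 : 0 < (B 0%N).2 by have [] := hB 0%N.
have rhop s : 0 < (B s).2 by rewrite rhoE mulr_gt0 // exprn_gt0.
have hrho : (fun s => (B s).2) @ \oo --> 0.
  under eq_fun do rewrite rhoE.
  rewrite -(mul0r (B 0%N).2); apply: cvgMr_tmp; apply: cvg_expr.
  by rewrite ger0_norm // ltW.
have hstep f : nonexpansive euclidean_dist f ->
    forall s, `|f (B s).1 - f (B s.+1).1| + (B s.+1).2 <= (B s).2.
  move=> hf s; have h1 := hleg B s (hB s).
  have [_ _ /(_ s (ltnSn s)) h2] := hB s.+1.
  exact: (reply_nonexpansive _ _ _ _ _ _ _ _ hf h1 h2).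
have [||y [Cy hy hdist]] := play_outcome _ phi a b mu K _ mu0 hg hmu hK
  (fun s => (B s).2) (fun s => (B s).1) _ hrho hstep.
- by move=> s; rewrite -CE.
- by move=> s; exact: ltW.
rewrite -CE in Cy; exists y; first by split.
split=> //; have [L hL] := havoid B hB.
apply: (@outcome_bad R n m k Theta i0 hm hk hi0 theta (B 0%N).2 r1 th rho00 r10 L
  (fun s => (B s).1) y (fun s => l (t theta) (t (B s).2) (B s).1)
  (fun s => l (Q (B 0%N).2) 1 (B s).1)).
- move=> s i; rewrite -rhoE; exact: (hdist _ (coord_nonexpansive n i)).
- move=> s z; rewrite -!rhoE => hs hz; have := hL s z.
  by rewrite /obs hs => /(_ hz); rewrite /near_ball -ltNge.
- move=> s q p; rewrite -!rhoE => hs hq hp.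
  have [_] := hl (t theta) (t (B s).2) (B s).1; apply=> //.
    by apply: scale_ge1 => //; rewrite th0 ltW.
  by apply: scale_ge1 => //; rewrite rhop (le_trans hs).
move=> s q p hs hq hp.
have [_] := hl (Q (B 0%N).2) 1 (B s).1; apply=> //.
- apply: scale_ge1 => //; rewrite lt_min rho00 mulr_gt0 //= ge_min.
  by rewrite mulr_ile1 ?orbT // ltW.
- by rewrite mulr1.
by move=> i; rewrite powR1 mul1r; exact: hp.
Qed.
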